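(* Let $\ell\geqslant 1$ be an integer and let $f\colon\mathbb Z_{\geqslant}\to\mathbb C$. The discrete generating series $F(\xi,\ell;z)=\sum_{x=0}^{\infty}f(x)\xi^xz^{\underline{\ell x}}$ is $D$-finite if and only if the sequence $f(x)$ is $p$-recursive.
   Context: $\mathbb Z_{\geqslant}$ denotes the non-negative integers and $z^{\underline n}=z(z-1)\cdots(z-n+1)$ is the falling factorial ($z^{\underline 0}=1$). Discrete generating series are formal: power series in $\xi$ whose coefficients are polynomials in $z$; operators in $z$ act coefficientwise. Let $\rho g(z)=g(z-1)$, $\Delta g(z)=g(z+1)-g(z)$, and $\theta=\ell^{-1}z\rho\Delta$, i.e. $\theta g(z)=\ell^{-1}z\,(g(z)-g(z-1))$. In a product such as $z^{\underline{i\ell}}\rho^{i\ell}$, first $\rho^{i\ell}$ is applied, then multiplication by $z^{\underline{i\ell}}$. The sequence $f$ is $p$-recursive (polynomially recursive) if there exist $r\in\mathbb Z_\geqslant$ and polynomials $p_0,\dots,p_r\in\mathbb C[x]$, with $p_r$ not identically zero, such that $\sum_{k=0}^{r}p_k(x)f(x+k)=0$ for all integers $x\geqslant 0$. The series $F(\xi,\ell;z)$ is $D$-finite if there exist $r\in\mathbb Z_\geqslant$ and operators $$P_j(\xi,\ell;z)=\sum_{i=0}^{k_j}d_{i,j}\,\xi^iz^{\underline{i\ell}}\rho^{i\ell},\qquad d_{i,j}\in\mathbb C,\ k_j\in\mathbb Z_\geqslant,\ j=0,\dots,r,$$ at least one of which is non-zero (i.e. not all $d_{i,j}$ vanish), such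 that $$\Big(P_r(\xi,\ell;z)\theta^r+\cdots+P_1(\xi,\ell;z)\theta+P_0(\xi,\ell;z)\Big)F(\xi,\ell;z)=0.$$ *)

(* Defs.v *)
From HB Require Import structures.
From mathcomp Require Import all_boot all_order all_algebra.

Set Implicit Arguments.
Unset Strict Implicit.
Unset Printing Implicit Defensive.

Import GRing.Theory.

Local Open Scope ring_scope.

(* A formal power series in xi over C[z]: F n is the coefficient of xi^n, and
   the polynomial variable 'X is z. *)
Definition dseries (C : fieldType) := nat -> {poly C}.

Definition ffactp (C : fieldType) (n : nat) : {poly C} :=
  \prod_(i < n) ('X - i%:R%:P).

Definition rho (C : fieldType) (g : {poly C}) : {poly C} := g \Po ('X - 1).

Definition Delta (C : fieldType) (g : {poly C}) : {poly C} :=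
  g \Po ('X + 1) - g.

Definition theta (C : fieldType) (l : nat) (g : {poly C}) : {poly C} :=
  l%:R^-1 *: ('X * rho (Delta g)).

Definition coefwise (C : fieldType) (A : {poly C} -> {poly C})
    (F : dseries C) : dseries C :=
  fun n => A (F n).

Definition mulxi (C : fieldType) (i : nat) (F : dseries C) : dseries C :=
  fun n => if (i <= n)%N then F (n - i)%N else 0.

(* The operator sum_(i <= k) d_i xi^i z^{\underline{i l}} rho^(i l). *)
Definition xiop (C : fieldType) (l k : nat) (d : nat -> C)
    (F : dseries C) : dseries C :=
  fun n => \sum_(i < k.+1)
    d i *: mulxi i
      (coefwise (fun g => ffactp C (i * l) * iter (i * l) (@rho C) g) F) n.

(* P_j is given by its order k j and its coefficients d i j for i <= k j; the
   values of k and d outside j <= r, i <= k j are irrelevant. *)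
Definition D_finite (C : fieldType) (l : nat) (F : dseries C) : Prop :=
  exists (r : nat) (k : nat -> nat) (d : nat -> nat -> C),
    (exists i j : nat, [/\ (j <= r)%N, (i <= k j)%N & d i j != 0]) /\
    (forall n : nat,
      \sum_(j < r.+1)
        xiop l (k j) (fun i => d i j) (iter j (coefwise (theta l)) F) n = 0).

Definition p_recursive (C : fieldType) (f : nat -> C) : Prop :=
  exists (r : nat) (p : nat -> {poly C}),
    p r != 0 /\
    (forall x : nat, \sum_(k < r.+1) (p k).[x%:R] * f (x + k)%N = 0).

Definition gen_series (C : fieldType) (l : nat) (f : nat -> C) : dseries C :=
  fun x => f x *: ffactp C (l * x).

(* Main.v *)
(** The operator [theta] multiplies z^{\underline{l x}} by x, and
    xi^i z^{\underline{i l}} rho^(i l) sends xi^x z^{\underline{l x}} to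
    xi^(x+i) z^{\underline{l (x+i)}}.  Comparing coefficients, D-finiteness of
    the generating series means that sum_(i <= min(K, n)) q_i(n - i) f(n - i)
    vanishes for all n >= 0, with polynomials q_0, ..., q_K not all zero.  For
    n >= K this is a polynomial recurrence after the substitution n = x + K.
    Conversely, a recurrence of order r gives such relations for n >= r only;
    multiplying them by n (n - 1) ... (n - r + 1) makes them hold for all n. *)
Require Import Defs.
From HB Require Import structures.
From mathcomp Require Import all_boot all_order all_algebra.
From mathcomp Require Import complex.
From mathcomp Require Import reals.

Set Implicit Arguments.
Unset Strict Implicit.
Unset Printing Implicit Defensive.

Import GRing.Theory Num.Theory.

Local Open Scope ring_scope.
Local Open Scope complex_scope.

Section FallingFactorial.
Variable C : fieldType.
Implicit Types (g h : {poly C}) (c : C) (m n l : nat).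

Lemma rhoM g h : rho (g * h) = rho g * rho h.
Proof. exact: comp_polyM. Qed.

Lemma rhoZ c g : rho (c *: g) = c *: rho g.
Proof. exact: comp_polyZ. Qed.

Lemma iter_rhoZ n c g : iter n (@rho C) (c *: g) = c *: iter n (@rho C) g.
Proof. by elim: n => //= n ->; rewrite rhoZ. Qed.

Lemma ffactp_recr n : ffactp C n.+1 = ffactp C n * ('X - n%:R%:P).
Proof. by rewrite /ffactp big_ord_recr. Qed.

Lemma ffactp_recl n : ffactp C n.+1 = 'X * rho (ffactp C n).
Proof.
rewrite /ffactp big_ord_recl subr0 /rho rmorph_prod; congr (_ * _).
apply: eq_bigr => i _; rewrite /= comp_polyB comp_polyX comp_polyC -addrA -opprD.
by rewrite natrD polyCD.
Qed.

Lemma ffactpD m n :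
  ffactp C (m + n) = ffactp C m * iter m (@rho C) (ffactp C n).
Proof.
elim: m => [|m IHm]; first by rewrite /ffactp big_ord0 mul1r.
by rewrite addSn !ffactp_recl IHm rhoM mulrA.
Qed.

Lemma ffactp_neq0 n : ffactp C n != 0.
Proof. by apply/prodf_neq0 => i _; rewrite polyXsubC_eq0. Qed.

Lemma horner_ffactp_eq0 m n : (m < n)%N -> (ffactp C n).[m%:R] = 0.
Proof.
move=> lt_mn; rewrite /ffactp horner_prod (bigD1 (Ordinal lt_mn)) //=.
by rewrite hornerXsubC subrr mul0r.
Qed.

Lemma rho_Delta g : rho (Delta g) = g - rho g.
Proof.
rewrite /rho /Delta comp_polyB -comp_polyA comp_polyD comp_polyX.
by rewrite comp_polyC subrK comp_polyXr.
Qed.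

Lemma thetaZ l c g : theta l (c *: g) = c *: theta l g.
Proof. by rewrite /theta !rho_Delta rhoZ -scalerBr -scalerAr !scalerA mulrC. Qed.

(** Splitting off the first or the last factor of $z^{\underline{n+1}}$ gives $z\,\rho z^{\underline
    n} = z^{\underline n}(z-n)$, so $z(1-\rho)$ acts on $z^{\underline n}$ as the scalar $n$; here
    $n = lx$ and [l] cancels. *)
Lemma theta_ffactp l x : l%:R != 0 :> C ->
  theta l (ffactp C (l * x)) = x%:R *: ffactp C (l * x).
Proof.
move=> l0; rewrite /theta rho_Delta mulrBr -ffactp_recl ffactp_recr.
rewrite mulrBr [_ * 'X]mulrC opprB addrCA subrr addr0 mulrC mul_polyC scalerA.
by rewrite natrM mulKf.
Qed.

Lemma iter_theta_gen_series l f j x : l%:R != 0 :> C ->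
  iter j (coefwise (theta l)) (gen_series l f) x =
  (x%:R ^+ j * f x) *: ffactp C (l * x).
Proof.
move=> l0; elim: j => [|j IHj] /=; first by rewrite mul1r.
by rewrite /coefwise IHj thetaZ theta_ffactp // scalerA exprSr mulrAC.
Qed.

Lemma xiop_theta_gen_series l k d f j n : l%:R != 0 :> C ->
  xiop l k d (iter j (coefwise (theta l)) (gen_series l f)) n =
  (\sum_(i < k.+1 | (i <= n)%N) d i * (n - i)%:R ^+ j * f (n - i)%N)
    *: ffactp C (l * n).
Proof.
move=> l0; rewrite /xiop scaler_suml [RHS]big_mkcond; apply: eq_bigr => i _.
rewrite /mulxi; case: leqP => [le_in|_]; last by rewrite scaler0.
rewrite {1}/coefwise iter_theta_gen_series // iter_rhoZ -scalerAr scalerA mulrA.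
by rewrite [(l * _)%N]mulnC -ffactpD -mulnDl subnKC // mulnC.
Qed.

End FallingFactorial.

Section Recurrences.
Variable C : numFieldType.
Implicit Types (f : nat -> C) (l : nat).

(** The correspondence is $q_i = \sum_j d_{i,j} X^j$: powers of [theta] become powers of the index,
    and the common nonzero factor $z^{\underline{ln}}$ cancels. *)
Lemma D_finite_gen_seriesP l f : (0 < l)%N ->
  D_finite l (gen_series l f) <->
  exists (K : nat) (q : nat -> {poly C}),
    (exists2 i, (i <= K)%N & q i != 0) /\
    (forall n : nat, \sum_(i < K.+1 | (i <= n)%N)
       (q i).[(n - i)%:R] * f (n - i)%N = 0).
Proof.
move=> l_gt0; have l0 : l%:R != 0 :> C by rewrite pnatr_eq0 -lt0n.
split=> [[r [k [d [[i [j [le_jr le_ik d0]]] Fn]]]]|[K [q [[i le_iK qi0] fn]]]].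
(* The orders [k j] differ, so all operators are padded to the common order [K]; entries of [d]
   beyond [k j] are arbitrary and must be replaced by 0. *)
- pose K := (\max_(j < r.+1) k j)%N.
  have le_kK (j' : 'I_r.+1) : (k j' <= K)%N by exact: leq_bigmax.
  exists K, (fun i => \poly_(j < r.+1) (if (i <= k j)%N then d i j else 0)).
  split.
    exists i; first exact: leq_trans le_ik (le_kK (Ordinal (le_jr : j < r.+1)%N)).
    apply: contraNneq d0 => /polyP/(_ j).
    by rewrite coef_poly coef0 ltnS le_jr le_ik => ->.
  move=> n; apply/eqP; have /eqP := Fn n.
  under eq_bigr do rewrite xiop_theta_gen_series //.
  rewrite -scaler_suml scaler_eq0 (negPf (ffactp_neq0 _ _)) orbF.
  congr (_ == 0); under [RHS]eq_bigr do rewrite horner_poly mulr_suml.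
  rewrite exchange_big /=; apply: eq_bigr => j' _.
  have le_kK' : ((k j').+1 <= K.+1)%N by rewrite ltnS le_kK.
  rewrite (big_ord_widen_cond K.+1 (fun i => i <= n)%N
    (fun i => d i j' * (n - i)%:R ^+ j' * f (n - i)%N)) //.
  rewrite big_mkcondr; apply: eq_bigr => i' _.
  by rewrite ltnS; case: ifP => // _; rewrite !mul0r.
- pose r := (\max_(i < K.+1) size (q i))%N.
  exists r, (fun=> K), (fun i j => (q i)`_j); split.
    (* The nonzero entry of [d] is the leading coefficient of [q i]. *)
    exists i, (size (q i)).-1; split=> //; last by rewrite -lead_coefE lead_coef_eq0.
    apply: leq_trans (leq_pred _) _.
    exact: (leq_bigmax (Ordinal (le_iK : i < K.+1)%N)).
  move=> n; under eq_bigr do rewrite xiop_theta_gen_series //.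
  rewrite -scaler_suml exchange_big /= -[RHS](scale0r (ffactp C (l * n))).
  rewrite -[in RHS](fn n); congr (_ *: _); apply: eq_bigr => i' _.
  rewrite (@horner_coef_wide _ r.+1) ?mulr_suml //.
  by apply: leqW; apply: (leq_bigmax i').
Qed.

Lemma comp_poly_XaddC_neq0 (p : {poly C}) c : p != 0 -> p \Po ('X + c%:P) != 0.
Proof. by rewrite comp_poly2_eq0 // size_XaddC. Qed.

(** Vanishing top coefficients are dropped one by one until the leading one is nonzero, as
    [p_recursive] demands. *)
Lemma p_recursive_neq0 f K (p : nat -> {poly C}) :
    (exists2 k, (k <= K)%N & p k != 0) ->
    (forall x, \sum_(k < K.+1) (p k).[x%:R] * f (x + k)%N = 0) ->
  p_recursive f.
Proof.
elim: K => [|K IHK] [k le_kK pk0] fx.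
  by exists 0, p; split=> //; move: le_kK pk0; rewrite leqn0 => /eqP->.
have [pK0|] := eqVneq (p K.+1) 0; last by exists K.+1, p.
apply: IHK => [|x].
  exists k => //; rewrite -ltnS ltn_neqAle le_kK andbT.
  by apply: contraNneq pk0 => ->; rewrite pK0.
by have := fx x; rewrite big_ord_recr /= pK0 horner0 mul0r addr0.
Qed.

Lemma D_finite_gen_series_p_recursive l f : (0 < l)%N ->
  D_finite l (gen_series l f) <-> p_recursive f.
Proof.
move=> l_gt0; apply: iff_trans (D_finite_gen_seriesP f l_gt0) _.
split=> [[K [q [[i le_iK qi0] fn]]]|[r [p [pr0 fx]]]].
(* With $n = x + K$ and $i = K - k$, the argument $n - i$ of $q_i$ is $x + k$. *)
- apply: (@p_recursive_neq0 f K (fun k => q (K - k)%N \Po ('X + k%:R%:P))).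
    exists (K - i)%N; first exact: leq_subr.
    by rewrite subKn //; apply: comp_poly_XaddC_neq0.
  move=> x; rewrite -[RHS](fn (x + K)%N) [LHS](reindex_inj rev_ord_inj) /=.
  apply: eq_big => [i'|i' _].
    by rewrite (leq_trans _ (leq_addl _ _)) // -ltnS.
  have le_i'K : (i' <= K)%N by rewrite -ltnS.
  rewrite subSS subKn // horner_comp hornerD hornerX hornerC -natrD.
  by rewrite addnBA.
(* The shifts are chosen so that at $n - i$ the first factor is $n^{\underline r}$, independent of
   $i$, and for $n \geqslant r$ the second is $p_{r-i}(n-r)$. *)
- exists r, (fun i => (ffactp C r \Po ('X + i%:R%:P)) *
                      (p (r - i)%N \Po ('X + (- (r - i)%:R)%:P))).
  split.
    exists 0%N => //; rewrite subn0.
    by rewrite mulf_neq0 ?comp_poly_XaddC_neq0 ?ffactp_neq0.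
  move=> n.
  have ffE i : (i <= n)%N ->
      (ffactp C r \Po ('X + i%:R%:P)).[(n - i)%:R] = (ffactp C r).[n%:R].
    by move=> le_in; rewrite horner_comp hornerD hornerX hornerC -natrD subnK.
  (* For $n < r$ the sum is truncated and the recurrence says nothing, but $n^{\underline r} = 0$
     kills every term. *)
  have [lt_nr|le_rn] := ltnP n r.
    by rewrite big1 // => i le_in; rewrite hornerM ffE // horner_ffactp_eq0 ?mul0r.
  rewrite -[RHS](mulr0 (ffactp C r).[n%:R]) -[in RHS](fx (n - r)%N) mulr_sumr.
  rewrite [RHS](reindex_inj rev_ord_inj) /=.
  have le_ir (i : 'I_r.+1) : (i <= r)%N by rewrite -ltnS.
  apply: eq_big => [i|i le_in]; first by rewrite (leq_trans (le_ir i)).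
  rewrite hornerM ffE // subSS -mulrA; congr (_ * _).
  have nE : (n - i = n - r + (r - i))%N by rewrite addnBA // subnK.
  by rewrite horner_comp hornerD hornerX hornerC nE natrD addrK.
Qed.

End Recurrences.

Theorem theorem2 (R : realType) (l : nat) (hl : (1 <= l)%N) (f : nat -> R[i]) :
  D_finite l (gen_series l f) <-> p_recursive f.
Proof. exact: D_finite_gen_series_p_recursive. Qed.
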